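(* Let $1\le k\le N$ and let $\lambda=(\lambda_1\ge\cdots\ge\lambda_N)$ be a signature of size $N$. Then, as an identity of rational functions in $x_1,\dots,x_k$, $$S_\lambda(x_1,\dots,x_k;N,1)=\frac{1}{\prod_{i<j}(x_i-x_j)}\prod_{i=1}^k\frac{(N-i)!}{(x_i-1)^{N-k}}\;\det\bigl[D_{x_i}^{\,j-1}\bigr]_{i,j=1}^k\left(\prod_{j=1}^k S_\lambda(x_j;N,1)\frac{(x_j-1)^{N-1}}{(N-1)!}\right),$$ where $D_x$ is the differential operator $x\frac{\partial}{\partial x}$.
   Context: A signature of size $N$ is an $N$-tuple of integers $\lambda_1\ge\cdots\ge\lambda_N$. The rational Schur function is the symmetric Laurent polynomial $$s_\lambda(u_1,\dots,u_N)=\frac{\det\bigl[u_i^{\lambda_j+N-j}\bigr]_{i,j=1}^N}{\prod_{i<j}(u_i-u_j)},$$ and $$S_\lambda(x_1,\dots,x_k;N,1)=\frac{s_\lambda(x_1,\dots,x_k,\overbrace{1,\dots,1}^{N-k})}{s_\lambda(\underbrace{1,\dots,1}_{N})}.$$ The operators $D_{x_1},\dots,D_{x_k}$ commute, so $\det[D_{x_i}^{j-1}]_{i,j=1}^k$ ($i$ row index, $j$ column index) is a well-defined differential operator. *)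

(* Defs.v *)
From mathcomp Require Import all_boot all_fingroup all_algebra.
From mathcomp Require Import mpoly generic_quotient ring zify.

Set Implicit Arguments.
Unset Strict Implicit.
Unset Printing Implicit Defensive.

Import GRing.Theory.
Local Open Scope ring_scope.
Local Open Scope quotient_scope.

Notation ratfun F n := {fraction {mpoly F[n]}}.
Notation "p %:F" := (@FracField.tofrac _ p) : ring_scope.

Definition ratvar (F : fieldType) n (i : 'I_n) : ratfun F n := ('X_i)%:F.

Definition ratconst (F : fieldType) n (c : F) : ratfun F n := (c%:MP)%:F.

Arguments ratvar F {n} i.
Arguments ratconst {F} n c.

Section Laurent.
Variables (F : fieldType) (n : nat).

Definition laurent_repr (f : ratfun F n) (pm : {mpoly F[n]} * nat) : bool :=
  f == pm.1%:F / (\prod_(i < n) ratvar F i) ^+ pm.2.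

Definition is_laurent (f : ratfun F n) : Prop := exists pm, laurent_repr f pm.

(* Meaningful when all [v i] are nonzero: the value is then independent of the
   chosen representation, see [laurent_evalE]. *)
Definition laurent_eval k (f : ratfun F n) (hf : is_laurent f)
    (v : 'I_n -> ratfun F k) : ratfun F k :=
  let pm := xchoose hf in
  mmap (ratconst k) v pm.1 / (\prod_(i < n) v i) ^+ pm.2.

Lemma ratconst_is_rmorph k : exists g : {rmorphism F -> ratfun F k}, g =1 ratconst k.
Proof. by exists (@FracField.tofrac {mpoly F[k]} \o @mpolyC k F : {rmorphism _ -> _}). Qed.

Lemma ratvar_prod_neq0 : \prod_(i < n) ratvar F i != 0.
Proof.
apply/prodf_neq0 => i _; rewrite /ratvar tofrac_eq0.
by rewrite -msize_poly_eq0 msizeX.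
Qed.

Lemma laurent_evalE k (f : ratfun F n) (hf : is_laurent f) (v : 'I_n -> ratfun F k)
    (p : {mpoly F[n]}) (m : nat) :
  (forall i, v i != 0) ->
  f = p%:F / (\prod_(i < n) ratvar F i) ^+ m ->
  laurent_eval hf v = mmap (ratconst k) v p / (\prod_(i < n) v i) ^+ m.
Proof.
move=> v0 fE; rewrite /laurent_eval; case: (xchoose hf) (xchooseP hf) => q l.
rewrite /laurent_repr fE /= => /eqP.
have X0 := ratvar_prod_neq0.
have V0 : \prod_(i < n) v i != 0 by apply/prodf_neq0.
move/eqP; rewrite eqr_div ?expf_neq0 // /ratvar -rmorph_prod -!rmorphXn -!rmorphM.
rewrite tofrac_eq => /eqP E.
have [g gE] := ratconst_is_rmorph k.
have mE r : mmap (ratconst k) v r = mmap g v r.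
  by rewrite /mmap; apply: eq_bigr => ? _; rewrite gE.
have := congr1 (mmap g v) E.
rewrite !rmorphM !rmorphXn rmorph_prod /=.
under eq_bigr do rewrite mmapX mmap1U.
move=> E'; apply/eqP; rewrite eqr_div ?expf_neq0 // !mE.
by rewrite E'.
Qed.

End Laurent.

Section Schur.
Variables (F : fieldType) (N : nat).

Definition is_signature (lam : N.-tuple int) : bool :=
  sorted (fun a b : int => b <= a) lam.

Definition schur (lam : N.-tuple int) : ratfun F N :=
  \det (\matrix_(i < N, j < N) ratvar F i ^ (tnth lam j + (N - j.+1)%:Z))
  / \prod_(i < N) \prod_(j < N | (i < j)%N) (ratvar F i - ratvar F j).

Let u (i : 'I_N) : {mpoly F[N]} := 'X_i.
Let vdm : 'M[{mpoly F[N]}]_N := \matrix_(i < N, l < N) u i ^+ l.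

(* Reduce each power modulo the monic polynomial of which the u_i are roots. *)
Lemma alternant_factor (e : 'I_N -> nat) :
  exists C : 'M[{mpoly F[N]}]_N, \matrix_(i < N, j < N) u i ^+ e j = vdm *m C.
Proof.
pose P : {poly {mpoly F[N]}} := \prod_(l < N) ('X - (u l)%:P).
have Pm : P \is monic by apply: monic_prod_XsubC.
pose r j := Pdiv.Ring.rmodp ('X^(e j)) P.
exists (\matrix_(l < N, j < N) (r j)`_l).
apply/matrixP => i j; rewrite !mxE.
have Pu : P.[u i] = 0.
  apply/rootP; rewrite /P -(big_map u xpredT (fun x => 'X - x%:P)) root_prod_XsubC.
  exact/map_f/mem_index_enum.
have -> : u i ^+ e j = (r j).[u i].
  rewrite -hornerXn [in LHS](Pdiv.RingMonic.rdivp_eq Pm 'X^(e j)) -/(r j).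
  by move: (Pdiv.Ring.rdivp _ _) => q; rewrite hornerD hornerM Pu mulr0 add0r.
have sz : (size (r j) <= N)%N.
  rewrite -ltnS; apply: leq_trans (Pdiv.Ring.ltn_rmodpN0 _ (monic_neq0 Pm)) _.
  by rewrite size_prod_XsubC /index_enum -enumT size_enum_ord.
rewrite (horner_coef_wide _ sz); apply: eq_bigr => l _.
by rewrite !mxE mulrC.
Qed.

Let denp : {mpoly F[N]} := \prod_(i < N) \prod_(j < N | (i < j)%N) (u i - u j).

Lemma denp_neq0 : denp != 0.
Proof.
apply/prodf_neq0 => i _; apply/prodf_neq0 => j ij.
have ij' : (i == j) = false by apply/negbTE; case: eqP ij => // ->; rewrite ltnn.
rewrite subr_eq0; apply/negP => /eqP/mpolyP/(_ U_(i)%MM)/eqP.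
by rewrite !mcoeffX !eq_mnm1 eqxx (eq_sym j) ij' oner_eq0.
Qed.

Lemma det_vdm : exists s : bool, \det vdm = (-1) ^+ s * denp.
Proof.
pose rv : 'S_N := perm (@rev_ord_inj N).
exists (odd_perm rv).
have -> : vdm = row_perm rv (Vandermonde N (\row_j u (rev_ord j)))^T.
  by apply/matrixP => i j; rewrite !mxE permE rev_ordK.
rewrite row_permE det_mulmx det_perm det_tr det_Vandermonde; congr (_ * _).
under eq_bigr => i _ do under eq_bigr => j _ do rewrite !mxE.
rewrite /denp pair_big_dep /= [RHS]pair_big_dep /=.
rewrite (reindex (fun p : 'I_N * 'I_N => (rev_ord p.2, rev_ord p.1))) /=.
  apply: eq_big => [[i j]|[i j] _] /=; last by rewrite !rev_ordK.
  by have := ltn_ord i; have := ltn_ord j; case: i j => i /= ? [j /= ?] *; lia.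
by exists (fun p => (rev_ord p.2, rev_ord p.1)) => -[i j] _ /=; rewrite !rev_ordK.
Qed.

Lemma schur_laurent (lam : N.-tuple int) : is_laurent (schur lam).
Proof.
pose M : nat := \sum_(j < N) `|tnth lam j|%N.
have Mge (j : 'I_N) : 0 <= tnth lam j + M%:Z.
  have : (`|tnth lam j|%N <= M)%N by rewrite /M (bigD1 j) //= leq_addr.
  lia.
pose e (j : 'I_N) : nat := (absz (tnth lam j + M%:Z)%R + (N - j.+1))%N.
have [C CE] := alternant_factor e.
have [s sE] := det_vdm.
exists ((-1) ^+ s * \det C, M); rewrite /laurent_repr /=.
have X0 := ratvar_prod_neq0 F N.
have D0 : \prod_(i < N) \prod_(j < N | (i < j)%N) (ratvar F i - ratvar F j) = denp%:F.
  rewrite /denp rmorph_prod; apply: eq_bigr => i _; rewrite rmorph_prod.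
  by apply: eq_bigr => j _; rewrite rmorphB.
rewrite /schur D0 eqr_div ?expf_neq0 ?tofrac_eq0 ?denp_neq0 //.
have x0 (i : 'I_N) : ratvar F i != 0 by move/prodf_neq0: X0; apply.
have EE : (\det (\matrix_(i < N, j < N) u i ^+ e j))%:F =
  (\prod_(i < N) ratvar F i) ^+ M *
  \det (\matrix_(i < N, j < N) ratvar F i ^ (tnth lam j + (N - j.+1)%:Z)).
  rewrite -det_map_mx -prodrXl.
  have -> : \prod_(i < N) ratvar F i ^+ M = \det (diag_mx (\row_i ratvar F i ^+ M)).
    by rewrite det_diag; apply: eq_bigr => i _; rewrite mxE.
  rewrite -det_mulmx mul_diag_mx; congr (\det _).
  apply/matrixP => i j; rewrite !mxE rmorphXn /= -/(ratvar F i).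
  rewrite (exprnP _ (e j)) (exprnP _ M) -expfzDr //; congr (_ ^ _).
  by rewrite /e PoszD gez0_abs //; ring.
rewrite mulrC -EE CE det_mulmx sE -rmorphM; apply/eqP; congr _%:F.
by rewrite mulrAC.
Qed.

(* S_lambda(xs; N, 1): the arguments beyond [size xs] are set to 1. *)
Definition normalized_schur k (lam : N.-tuple int) (xs : seq (ratfun F k)) : ratfun F k :=
  laurent_eval (schur_laurent lam) (fun i : 'I_N => nth 1 xs i)
  / laurent_eval (schur_laurent lam) (fun _ : 'I_N => 1 : ratfun F k).

End Schur.

Section DiffOp.
Variables (F : fieldType) (k : nat).

(* x_i d/dx_i, by the quotient rule; independent of the representative, see
   [eulerE]. *)
Definition euler (i : 'I_k) (f : ratfun F k) : ratfun F k :=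
  let: (p, q) := frac (repr f) in
  ratvar F i * (p^`M(i) * q - p * q^`M(i))%:F / (q ^+ 2)%:F.

(* Leibniz expansion; each product is a composition, taken in row order. *)
Definition opdet (A : 'I_k -> 'I_k -> ratfun F k -> ratfun F k)
    (f : ratfun F k) : ratfun F k :=
  \sum_(s : 'S_k) (-1) ^+ s * (\big[comp/id]_(i < k) A i (s i)) f.

Lemma ratfun_repr (f : ratfun F k) :
  f = (frac (repr f)).1%:F / (frac (repr f)).2%:F.
Proof.
have d0 := denom_ratioP (repr f).
apply: (canRL (mulfK _)); first by rewrite tofrac_eq0.
move: d0; rewrite -[X in X * _]reprK; move: (repr f) => r d0.
rewrite /FracField.tofrac; unlock.
rewrite !piE; apply/eqmodP => /=.
by rewrite FracField.equivfE /FracField.mulf !numden_Ratio ?oner_neq0 ?mulr1 // mulrC.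
Qed.

Lemma eulerE i (p q : {mpoly F[k]}) : q != 0 ->
  euler i (p%:F / q%:F) =
  ratvar F i * (p^`M(i) * q - p * q^`M(i))%:F / (q ^+ 2)%:F.
Proof.
move=> q0; rewrite /euler; set f := p%:F / q%:F.
have := ratfun_repr f; have := denom_ratioP (repr f).
case: (frac (repr f)) => a b /= b0 E.
have {E} E : p * b = a * q.
  move/eqP: E; rewrite /f eqr_div ?tofrac_eq0 // -!rmorphM tofrac_eq.
  by move/eqP.
have dE := congr1 (mderiv i) E; rewrite !mderivM in dE.
apply/eqP; rewrite -!mulrA; apply/eqP; congr (_ * _); apply/eqP.
rewrite eqr_div ?tofrac_eq0 ?expf_neq0 // -!rmorphM tofrac_eq; apply/eqP.
rewrite -/(mderiv _ _).
have -> : (a^`M(i) * b - a * b^`M(i)) * q ^+ 2 =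
  b * q * (a^`M(i) * q + a * q^`M(i)) - (a * q) * (b^`M(i) * q + b * q^`M(i)) by ring.
rewrite -E -dE; ring.
Qed.

Lemma euler_comm i j (f : ratfun F k) : euler i (euler j f) = euler j (euler i f).
Proof.
have [->|/negbTE ij] := eqVneq i j; first by [].
have q0 := denom_ratioP (repr f).
rewrite (ratfun_repr f); move: q0; move: (frac (repr f)) => [p q] /= q0.
rewrite !eulerE // /ratvar -!rmorphM !eulerE ?expf_neq0 // /ratvar.
rewrite -!rmorphM; congr (_%:F / _).
rewrite !expr2 !(mderivM, mderivB) !mderivX !mnm1E (mderiv_comm i j).
rewrite eq_sym ij !scale0r (mderiv_comm i j q); ring.
Qed.

End DiffOp.

(* Main.v *)
Require Import Defs.
From HB Require Import structures.
From mathcomp Require Import all_boot all_fingroup all_algebra.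
From mathcomp Require Import mpoly generic_quotient ring zify.

(* Put l_j = lambda_j + N - j. Setting u_i = 1 for i > r in the ratio of
   alternants confluently gives a multiple of the determinant B_r whose rows are
   (x_i^{l_j})_j for i <= r and (l_j^{N-i})_j for i > r; in particular s_lambda
   at (1, ..., 1) is a multiple of the Vandermonde determinant B_0. Let c_j be
   the weights with sum_j c_j l_j^m = 0 for m < N - 1 and = 1 for m = N - 1.
   Multiplying on the right by the matrix (c_j l_j^m)_{j,m} makes B_r block upper
   triangular with a unipotent lower block, so that B_r / B_0 is the r x r
   determinant of the entries sum_j c_j l_j^m x_i^{l_j} = D_{x_i}^m phi(x_i), where
   phi(x) = sum_j c_j x^{l_j}. The case r = 1 identifies phi with
   S_lambda(x; N, 1) (x - 1)^{N-1} / (N-1)!, and the case r = k is the theorem. *)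

Set Implicit Arguments.
Unset Strict Implicit.
Unset Printing Implicit Defensive.

Import GRing.Theory.
Local Open Scope ring_scope.

(** * Block triangular and Vandermonde determinants *)

(** Cut after index [r], the matrix has zero lower left block and upper triangular lower right
    block. *)
Lemma det_upper_rows (R : comNzRingType) (N r : nat) (hr : (r <= N)%N)
    (D : 'M[R]_N) :
  (forall i j : 'I_N, (r <= i)%N -> (j < i)%N -> D i j = 0) ->
  \det D = \det (\matrix_(i < r, j < r) D (widen_ord hr i) (widen_ord hr j))
           * \prod_(i < N | (r <= i)%N) D i i.
Proof.
have [n NE] : exists n, N = (r + n)%N by exists (N - r)%N; rewrite subnKC.
subst N => D0; rewrite -[in LHS](submxK D).
have D0l : dlsubmx D = 0.
  apply/matrixP => i j; rewrite !mxE D0 //= ?leq_addr //.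
  by rewrite (leq_trans (ltn_ord j)) ?leq_addr.
rewrite D0l det_ublock; congr (_ * _).
  congr (\det _); apply/matrixP => i j; rewrite !mxE; congr (D _ _); exact: val_inj.
rewrite -det_tr det_trig; last first.
  apply/is_trig_mxP => i j ij; rewrite !mxE D0 //= ?leq_addr //.
  by rewrite ltn_add2l.
rewrite big_split_ord /= [X in _ = X * _]big_pred0 ?mul1r; last first.
  by move=> i; apply/negbTE; rewrite -ltnNge.
by apply: eq_big => [i|i _]; rewrite ?leq_addr // !mxE.
Qed.

(** Reversing the points and the exponents of the Vandermonde matrix introduces the same sign twice.
    This orientation matches the denominator of [schur]. *)
Lemma det_rev_vandermonde (R : comNzRingType) n (a : 'I_n -> R) :
  \det (\matrix_(i < n, j < n) a i ^+ (n - j.+1))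
  = \prod_(i < n) \prod_(j < n | (i < j)%N) (a i - a j).
Proof.
pose rv : 'S_n := perm (@rev_ord_inj n).
have -> : \matrix_(i < n, j < n) a i ^+ (n - j.+1)
  = row_perm rv (col_perm rv (Vandermonde n (\row_j a (rev_ord j)))^T).
  by apply/matrixP => i j; rewrite !mxE !permE rev_ordK.
rewrite row_permE col_permE !det_mulmx !det_perm det_tr odd_permV.
rewrite mulrCA -expr2 sqrr_sign mulr1 det_Vandermonde.
under eq_bigr => i _ do under eq_bigr => j _ do rewrite !mxE.
rewrite pair_big_dep /= [RHS]pair_big_dep /=.
rewrite (reindex (fun p : 'I_n * 'I_n => (rev_ord p.2, rev_ord p.1))) /=.
  apply: eq_big => [[i j]|[i j] _] /=; last by rewrite !rev_ordK.
  by have := ltn_ord i; have := ltn_ord j; case: i j => i /= ? [j /= ?] *; lia.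
by exists (fun p => (rev_ord p.2, rev_ord p.1)) => -[i j] _ /=; rewrite !rev_ordK.
Qed.

(** * The operator x d/dx - c on polynomials, expanded at x = 1 *)

Section ShiftedEuler.
Variable (R : comNzRingType).

(* [x d/dx - c] in the coordinate ['X = x - 1] centred at [x = 1]. *)
Definition shifted_euler (c : R) (f : {poly R}) : {poly R} :=
  ('X + 1) * f^`() - c *: f.

Lemma shifted_euler_linear c : linear (shifted_euler c).
Proof.
by move=> a f g; rewrite /shifted_euler !linearP /= -!mul_polyC; ring.
Qed.


Lemma iter_shifted_euler_linear c m : linear (iter m (shifted_euler c)).
Proof.
elim: m => [//|m IH] a f g; rewrite !iterS.
by rewrite (IH a f g) shifted_euler_linear.
Qed.

(** [('X + 1) ^+ n] is the monomial x^n, an eigenvector with eigenvalue n - c. *)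
Lemma iter_shifted_euler_X1 c m n :
  iter m (shifted_euler c) (('X + 1) ^+ n) = (n%:R - c) ^+ m *: ('X + 1) ^+ n.
Proof.
have E : shifted_euler c (('X + 1) ^+ n) = (n%:R - c) *: ('X + 1) ^+ n.
  rewrite /shifted_euler deriv_exp derivD derivX -[1]/(1%:P) derivC addr0 mul1r.
  rewrite scalerBl scaler_nat; congr (_ - _).
  by case: n => [|n]; rewrite ?mulr0n ?mulr0 // mulrnAr -exprS.
elim: m => [|m IH]; first by rewrite expr0 scale1r.
have := shifted_euler_linear c ((n%:R - c) ^+ m) (('X + 1) ^+ n) 0.
rewrite iterS IH !addr0 => ->.
have -> : shifted_euler c 0 = 0 by rewrite /shifted_euler deriv0 mulr0 scaler0 subr0.
by rewrite addr0 E scalerA -exprSr.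
Qed.

(** Each application lowers the order of vanishing at x = 1 by at most one, and the derivative of
    the power of ['X] multiplies the leading coefficient by the current exponent. Only this leading
    coefficient matters, so [h] is left unspecified. *)
Lemma iter_shifted_euler_Xn c m b (g : {poly R}) : (m <= b)%N ->
  exists h, iter m (shifted_euler c) (g * 'X^b) =
            (g *+ (b ^_ m) + h * 'X) * 'X^(b - m).
Proof.
elim: m => [|m IH] mb; first by exists 0; rewrite mul0r addr0 subn0 ffactn0.
have [h hE] := IH (ltnW mb); rewrite iterS hE.
have -> : (b - m = (b - m.+1).+1)%N by lia.
set d := (b - m.+1)%N; have dE : (b - m = d.+1)%N by rewrite /d; lia.
rewrite ffactnSr dE; move: (b ^_ m)%N => a.
(* After removal of the leading term [a * d.+1 * g], every remaining term has a factor ['X]; the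
   witness is the quotient. *)
exists (g^`() *+ a * 'X + g^`() *+ a + g *+ a *+ d.+1
        + (h^`() * 'X + h) * ('X + 1) + h * ('X + 1) *+ d.+1
        - c *: (g *+ a + h * 'X)).
rewrite /shifted_euler derivM derivXn derivD derivMn derivM derivX /= exprS.
rewrite -!mul_polyC mulrnA -[_ *+ d.+1]mulr_natr -[g *+ a]mulr_natr.
rewrite -[_ *+ d.+1]mulr_natr.
rewrite -[g^`() *+ a]mulr_natr; ring.
Qed.

(** Evaluation at 0 is evaluation at x = 1, since ['X] stands for x - 1. *)
Definition euler_at_one (c : R) (m : nat) (f : {poly R}) : R :=
  (iter m (shifted_euler c) f).[0].

Lemma euler_at_one_is_linear c m : scalar (euler_at_one c m).
Proof.
by move=> a f g; rewrite /euler_at_one iter_shifted_euler_linear !hornerE.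
Qed.

HB.instance Definition _ c m := GRing.isLinear.Build R {poly R} R _
  (euler_at_one c m) (euler_at_one_is_linear c m).

Lemma euler_at_one_X1 c m n : euler_at_one c m (('X + 1) ^+ n) = (n%:R - c) ^+ m.
Proof. by rewrite /euler_at_one iter_shifted_euler_X1 !hornerE expr1n mulr1. Qed.

Lemma euler_at_one_mulXn c m b g : (m < b)%N -> euler_at_one c m (g * 'X^b) = 0.
Proof.
move=> mb; have [h hE] := iter_shifted_euler_Xn c g (ltnW mb).
by rewrite /euler_at_one hE hornerM hornerXn expr0n subn_eq0 leqNgt mb mulr0.
Qed.

Lemma euler_at_one_Xn c m : euler_at_one c m 'X^m = m`!%:R.
Proof.
have [h hE] := iter_shifted_euler_Xn c 1 (leqnn m).
rewrite /euler_at_one -['X^m]mul1r hE subnn expr0 mulr1 ffactnn.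
by rewrite !(hornerE, hornerMn).
Qed.

End ShiftedEuler.

(** * The quotient of alternants and its confluent specializations *)

(* [p] is the quotient of [\det (u_i ^ e_j)] by the Vandermonde determinant. It is
   the determinant of the coefficients of the remainders of [x ^ e_j] modulo
   [\prod_l (x - u_l)], written in powers of [x - 1]; after the specialization
   [u = v], these remainders are recovered by functionals that kill the multiples
   of [\prod_l (x - v_l)], namely evaluation at [v_i] for [i < r], and
   [(x d/dx - c)^m] at [x = 1] for [m < N - r]. *)
Lemma alternant_quotient (F : fieldType) (N : nat) (e : 'I_N -> nat) :
  exists p : {mpoly F[N]},
  forall (K : fieldType) (h : {rmorphism F -> K}) (v : 'I_N -> K) (c : K)
    (r : nat) (hr : (r <= N)%N),
  (forall i : 'I_N, (r <= i)%N -> v i = 1) ->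
  mmap h v p *
    ((\prod_(i < r) \prod_(j < r | (i < j)%N)
        (v (widen_ord hr i) - v (widen_ord hr j)))
     * (\prod_(i < r) (v (widen_ord hr i) - 1) ^+ (N - r))
     * \prod_(i < N | (r <= i)%N) ((N - i.+1)`!)%:R) =
  \det (\matrix_(i < N, j < N)
     if (i < r)%N then v i ^+ e j else ((e j)%:R - c) ^+ (N - i.+1)).
Proof.
(* The roots are shifted by 1 because the polynomial variable stands for x - 1. *)
pose P : {poly {mpoly F[N]}} := \prod_(l < N) ('X - ('X_l - 1)%:P).
have Pm : P \is monic by apply: monic_prod_XsubC.
pose q j := Pdiv.Ring.rdivp (('X + 1) ^+ e j) P.
pose rem j := Pdiv.Ring.rmodp (('X + 1) ^+ e j) P.
(* Coefficients are listed by descending degree, so that the matrix [D] below has the shape needed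
   by [det_upper_rows]. *)
exists (\det (\matrix_(l < N, j < N) (rem j)`_(N - l.+1))).
move=> K h v c r hr v1; pose g : {rmorphism {mpoly F[N]} -> K} := mmap h v.
have gX l : g 'X_l = v l by rewrite /g /= mmapX mmap1U.
rewrite -[mmap h v _]/(g _).
have div j : ('X + 1) ^+ e j = map_poly g (q j) * \prod_(l < N) ('X - (v l - 1)%:P)
    + \sum_(l < N) g (rem j)`_(N - l.+1) *: 'X^(N - l.+1).
  have -> : ('X + 1) ^+ e j = map_poly g (('X + 1) ^+ e j).
    by rewrite rmorphXn rmorphD /= map_polyX rmorph1.
  rewrite [in LHS](Pdiv.RingMonic.rdivp_eq Pm (('X + 1) ^+ e j)) -/(q j) -/(rem j).
  rewrite rmorphD rmorphM /=; congr (_ * _ + _).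
    rewrite rmorph_prod; apply: eq_bigr => l _.
    rewrite rmorphB /= map_polyX map_polyC /= rmorphB rmorph1.
    by rewrite gX.
  have sz : (size (map_poly g (rem j)) <= N)%N.
    apply: leq_trans (size_poly _ _) _.
    rewrite -ltnS; apply: leq_trans (Pdiv.Ring.ltn_rmodpN0 _ (monic_neq0 Pm)) _.
    by rewrite size_prod_XsubC /index_enum -enumT size_enum_ord.
  rewrite -[LHS]coefK poly_def.
  rewrite (big_ord_widen _ (fun l => (map_poly g (rem j))`_l *: 'X^l) sz) big_mkcond.
  rewrite (reindex_inj rev_ord_inj) /=; apply: eq_bigr => l _.
  case: ltnP => // le; rewrite -coef_map /=.
    by rewrite ?coef_map.
  by rewrite nth_default // scale0r.
pose phi (i : 'I_N) (f : {poly K}) :=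
  if (i < r)%N then f.[v i - 1] else euler_at_one c (N - i.+1) f.
have phi_lin i a f f' : phi i (a *: f + f') = a * phi i f + phi i f'.
  by rewrite /phi; case: ifP => _; rewrite ?linearP // !hornerE.
have phi0 i : phi i 0 = 0.
  by have := phi_lin i (-1) 0 0; rewrite scaler0 addr0 mulN1r addNr.
have phi_sum i (a : 'I_N -> K) (f : 'I_N -> {poly K}) :
    phi i (\sum_(l < N) a l *: f l) = \sum_(l < N) phi i (f l) * a l.
  apply: (big_rec2 (fun x y => phi i x = y)) => // l x y _ <-.
  by rewrite phi_lin mulrC.
have phi_P i f : phi i (f * \prod_(l < N) ('X - (v l - 1)%:P)) = 0.
  rewrite /phi; case: ltnP => ir.
    by rewrite (bigD1 i) //= mulrCA hornerM hornerXsubC subrr mul0r.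
  (* The points equal to 1 contribute ['X^(N - r)], and a functional of order N - i - 1 < N - r
     kills its multiples. *)
  rewrite (bigID (fun l : 'I_N => (l < r)%N)) /= mulrA.
  have -> : \prod_(l < N | ~~ (l < r)%N) ('X - (v l - 1)%:P) = 'X^(N - r).
    transitivity (\prod_(l < N | (r <= l)%N) ('X : {poly K})).
      apply: eq_big => [l|l]; rewrite -leqNgt // => /v1 ->.
      by rewrite subrr polyC0 subr0.
    by rewrite -(big_geq_mkord r N xpredT (fun=> 'X)) prodr_const_nat.
  by rewrite euler_at_one_mulXn //; have := ltn_ord i; lia.
have phi_X1 i n : phi i (('X + 1) ^+ n) =
    if (i < r)%N then v i ^+ n else (n%:R - c) ^+ (N - i.+1).
  by rewrite /phi; case: ifP => _; rewrite ?euler_at_one_X1 // !hornerE subrK.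
(* Applying [phi i] to the division identity leaves only the remainder, so the target matrix factors
   through the values of [phi] on monomials. *)
pose D := \matrix_(i < N, l < N) phi i 'X^(N - l.+1).
have -> : \matrix_(i < N, j < N)
     (if (i < r)%N then v i ^+ e j else ((e j)%:R - c) ^+ (N - i.+1))
   = D *m map_mx g (\matrix_(l < N, j < N) (rem j)`_(N - l.+1)).
  apply/matrixP => i j; rewrite !mxE -phi_X1 div -[_ * _]scale1r phi_lin phi_P.
  by rewrite mulr0 add0r phi_sum; apply: eq_bigr => l _; rewrite !mxE.
rewrite det_mulmx det_map_mx [RHS]mulrC; congr (_ * _).
rewrite (det_upper_rows hr); last first.
  move=> i j ri ji; rewrite mxE /phi ltnNge ri /=.
  have := @euler_at_one_mulXn K c (N - i.+1) (N - j.+1) 1; rewrite mul1r => -> //.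
  have := ltn_ord i; lia.
congr (_ * _); last first.
  apply: eq_bigr => i ri.
  by rewrite mxE /phi ltnNge ri /= euler_at_one_Xn.
pose w (i : 'I_r) := v (widen_ord hr i) - 1.
(* Row [i] consists of the powers N - j - 1 of [w i]; the common factor of exponent N - r leaves a
   Vandermonde matrix of size [r]. *)
rewrite (_ : \matrix_(i, j) _ = diag_mx (\row_i w i ^+ (N - r))
   *m \matrix_(i < r, j < r) w i ^+ (r - j.+1)); last first.
  apply/matrixP => i j; rewrite mul_diag_mx !mxE /phi /= ltn_ord hornerXn.
  by rewrite -exprD; congr (_ ^+ _); have := ltn_ord j; lia.
rewrite det_mulmx det_diag det_rev_vandermonde mulrC; congr (_ * _).
  by apply: eq_bigr => i _; rewrite mxE.
apply: eq_bigr => i _; apply: eq_bigr => j _; rewrite /w; ring.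
Qed.

(** * Evaluating the Schur function when trailing arguments equal 1 *)

Lemma ratvar_neq0 (F : fieldType) k (i : 'I_k) : ratvar F i != 0.
Proof. by have /prodf_neq0 := ratvar_prod_neq0 F k; apply. Qed.

Lemma ratvar_inj (F : fieldType) k : injective (@ratvar F k).
Proof.
move=> i j /eqP; rewrite /ratvar tofrac_eq => /eqP/mpolyP/(_ U_(i)%MM)/eqP.
rewrite !mcoeffX !eq_mnm1 eqxx; have [//|] := eqVneq j i.
by rewrite oner_eq0.
Qed.

Lemma mmap_ratvar (F : fieldType) k (h : {rmorphism F -> ratfun F k})
    (p : {mpoly F[k]}) :
  h =1 ratconst k -> mmap h (@ratvar F k) p = p%:F.
Proof.
move=> hE; rewrite [in RHS](mpolyE p) rmorph_sum /mmap /=.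
apply: eq_bigr => m _; rewrite hE -mul_mpolyC rmorphM; congr (_ * _).
rewrite mpolyXE_id rmorph_prod /mmap1; apply: eq_bigr => i _.
by rewrite rmorphXn.
Qed.

(** The exponent l_j, with [j] counted from 0. *)
Definition shifted_part N (lam : N.-tuple int) (j : 'I_N) : int :=
  tnth lam j + (N - j.+1)%:Z.

(** [alternant_quotient] requires natural exponents, so it is applied to l_j + M. It serves twice:
    at the variables themselves, to show that its quotient represents [schur] up to a monomial, and
    then at [v]. *)
Lemma laurent_eval_schur (F : fieldType) N (lam : N.-tuple int) k
    (v : 'I_N -> ratfun F k) r (hr : (r <= N)%N) :
  (forall i, v i != 0) -> (forall i : 'I_N, (r <= i)%N -> v i = 1) ->
  laurent_eval (schur_laurent F lam) v *
    ((\prod_(i < r) \prod_(j < r | (i < j)%N)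
        (v (widen_ord hr i) - v (widen_ord hr j)))
     * (\prod_(i < r) (v (widen_ord hr i) - 1) ^+ (N - r))
     * \prod_(i < N | (r <= i)%N) ((N - i.+1)`!)%:R) =
  \det (\matrix_(i < N, j < N)
     if (i < r)%N then v i ^ shifted_part lam j
     else (shifted_part lam j)%:~R ^+ (N - i.+1)).
Proof.
move=> v0 v1.
pose M : nat := \sum_(j < N) `|tnth lam j|%N.
have Mge (j : 'I_N) : 0 <= tnth lam j + M%:Z.
  have : (`|tnth lam j|%N <= M)%N by rewrite /M (bigD1 j) //= leq_addr.
  lia.
pose e (j : 'I_N) : nat := (absz (tnth lam j + M%:Z)%R + (N - j.+1))%N.
have eE j : (e j)%:Z = shifted_part lam j + M%:Z.
  by rewrite /e /shifted_part PoszD gez0_abs //; ring.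
have [p pE] := alternant_quotient F e.
(* The shift by [M] multiplies an upper row by [u i ^+ M]; in the lower rows it is undone by the
   choice c = M. *)
have row_scale n (u : 'I_N -> ratfun F n) s : (forall i, u i != 0) ->
    (forall i : 'I_N, (s <= i)%N -> u i = 1) ->
  \det (\matrix_(i < N, j < N) if (i < s)%N then u i ^+ e j
          else ((e j)%:R - M%:R) ^+ (N - i.+1)) =
  (\prod_i u i) ^+ M * \det (\matrix_(i < N, j < N)
     if (i < s)%N then u i ^ shifted_part lam j
     else (shifted_part lam j)%:~R ^+ (N - i.+1)).
  move=> u0 u1; rewrite -prodrXl.
  have -> : \prod_i u i ^+ M = \det (diag_mx (\row_i u i ^+ M)).
    by rewrite det_diag; apply: eq_bigr => i _; rewrite mxE.
  rewrite -det_mulmx mul_diag_mx; congr (\det _); apply/matrixP => i j.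
  rewrite !mxE; case: ltnP => si.
    by rewrite (exprnP _ (e j)) (exprnP _ M) -expfzDr // eE addrC.
  rewrite u1 // expr1n mul1r; congr (_ ^+ _).
  by rewrite -[(e j)%:R]/((e j)%:Z%:~R) eE rmorphD /= addrK.
have [hN hNE] := ratconst_is_rmorph F N.
have schurE : schur F lam = p%:F / (\prod_(i < N) ratvar F i) ^+ M.
  (* With r = N there are no confluent rows, and the formula becomes the defining ratio of
     alternants. *)
  have no_tail (i : 'I_N) : (N <= i)%N -> ratvar F i = 1 by rewrite leqNgt ltn_ord.
  have := pE _ hN (@ratvar F N) M%:R N (leqnn N) no_tail.
  rewrite row_scale //; last exact: ratvar_neq0.
  rewrite mmap_ratvar // [X in _ * (_ * X)]big_pred0; last first.
    by move=> i; rewrite leqNgt ltn_ord.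
  rewrite [X in _ * (_ * X * _)]big1 ?mulr1; last by move=> i _; rewrite subnn.
  have wE (i : 'I_N) : widen_ord (leqnn N) i = i by apply: val_inj.
  rewrite (eq_bigr (fun i : 'I_N => \prod_(j < N | (i < j)%N)
    (ratvar F i - ratvar F j)));
    last by move=> i _; apply: eq_bigr => j _; rewrite !wE.
  move=> E; apply/eqP; rewrite /schur eqr_div ?expf_neq0 ?ratvar_prod_neq0 //.
    rewrite E mulrC; apply/eqP; congr (_ * \det _).
    by apply/matrixP => i j; rewrite !mxE ltn_ord.
  apply/prodf_neq0 => i _; apply/prodf_neq0 => j ij; rewrite subr_eq0.
  by apply: contraTneq ij => /ratvar_inj ->; rewrite ltnn.
rewrite (laurent_evalE _ v0 schurE).
have [h hE] := ratconst_is_rmorph F k.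
have -> : mmap (ratconst k) v p = mmap h v p.
  by rewrite /mmap; apply: eq_bigr => ? _; rewrite hE.
apply: (@mulfI _ ((\prod_(i < N) v i) ^+ M)).
  by rewrite expf_neq0 //; apply/prodf_neq0.
rewrite -row_scale // -(pE _ h) // !mulrA; congr (_ * _ * _ * _).
by rewrite mulrAC mulfV ?mul1r // expf_neq0 //; apply/prodf_neq0.
Qed.

(** * Weights with prescribed moments and the reduction to a smaller determinant *)

(** The weights form the first row of the inverse of a Vandermonde matrix, invertible because the
    nodes are distinct. Its powers descend, so the first column carries the exponent N - 1. *)
Lemma moment_weights (F : fieldType) N (y : 'I_N -> F) : injective y ->
  exists c : 'I_N -> F,
  forall m, (m < N)%N -> \sum_j c j * y j ^+ m = (m.+1 == N)%:R.
Proof.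
case: N y => [|N] y y_inj; first by exists (fun=> 0).
pose A := \matrix_(i < N.+1, j < N.+1) y i ^+ (N.+1 - j.+1).
have Au : A \in unitmx.
  rewrite unitmxE det_rev_vandermonde unitfE.
  apply/prodf_neq0 => i _; apply/prodf_neq0 => j ij.
  by rewrite subr_eq0 (inj_eq y_inj) neq_ltn ij.
exists (fun j => invmx A ord0 j) => m mN.
have := congr1 (fun B : 'M_N.+1 => B ord0 (rev_ord (Ordinal mN))) (mulVmx Au).
rewrite !mxE /= => E; rewrite -[RHS]/((m.+1 == N.+1)%:R).
transitivity ((ord0 == rev_ord (Ordinal mN))%:R : F); last first.
  by congr (nat_of_bool _)%:R; rewrite -val_eqE /= eqSS; lia.
rewrite -E; apply: eq_bigr => j _; rewrite mxE; congr (_ * _ ^+ _).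
by rewrite /=; lia.
Qed.

(** Right multiplication by [G] turns the lower rows into moments. The case s = 0 shows that the
    determinant of [G] inverts that of the power matrix, which then moves to the other side. *)
Lemma det_moment_rows (R : comNzRingType) N (y c : 'I_N -> R) r (hr : (r <= N)%N)
    (X : 'I_N -> 'I_N -> R) :
  (forall m, (m < N)%N -> \sum_j c j * y j ^+ m = (m.+1 == N)%:R) ->
  \det (\matrix_(i < N, j < N) if (i < r)%N then X i j else y j ^+ (N - i.+1)) =
  \det (\matrix_(i < N, j < N) y j ^+ (N - i.+1)) *
  \det (\matrix_(i < r, m < r) \sum_j c j * y j ^+ m * X (widen_ord hr i) j).
Proof.
move=> cE.
pose B s := \matrix_(i < N, j < N) if (i < s)%N then X i j else y j ^+ (N - i.+1).
pose G := \matrix_(j < N, m < N) (c j * y j ^+ m).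
have key s (hs : (s <= N)%N) : \det (B s) * \det G =
    \det (\matrix_(i < s, m < s) \sum_j c j * y j ^+ m * X (widen_ord hs i) j).
  (* The entry is the moment of order N - i - 1 + m, which is at most N - 1, with equality only for
     m = i. *)
  have BG (i m : 'I_N) : (s <= i)%N -> (m <= i)%N -> (B s *m G) i m = (m == i)%:R.
    move=> si mi; rewrite mxE.
    transitivity (\sum_j c j * y j ^+ (N - i.+1 + m)).
      by apply: eq_bigr => j _; rewrite !mxE ltnNge si /= mulrCA -exprD.
    have := ltn_ord i; move=> iN; rewrite cE; last by lia.
    by congr (nat_of_bool _)%:R; apply/eqP/eqP => [E|->]; [apply: val_inj => /=|]; lia.
  rewrite -det_mulmx (det_upper_rows hs); last first.
    by move=> i j si ji; rewrite BG // ?(ltnW ji) // -val_eqE /= ltn_eqF.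
  rewrite [X in _ * X]big1 ?mulr1; last by move=> i si; rewrite BG // eqxx.
  congr (\det _); apply/matrixP => i m; rewrite !mxE; apply: eq_bigr => j _.
  by rewrite !mxE /= ltn_ord mulrC.
have A1 : \det (B 0%N) * \det G = 1 by rewrite (key _ (leq0n N)) det_mx00.
have <- : B 0%N = \matrix_(i < N, j < N) y j ^+ (N - i.+1).
  by apply/matrixP => i j; rewrite !mxE.
by rewrite -(key r hr) mulrCA A1 mulr1.
Qed.

(** * Euler operators on rational functions and their joint eigenvectors *)

Section Euler.
Variables (F : fieldType) (k : nat).
Implicit Types (f g : ratfun F k) (i : 'I_k).

Lemma ratfunP f : exists p q : {mpoly F[k]}, q != 0 /\ f = p%:F / q%:F.
Proof.
exists (frac (repr f)).1, (frac (repr f)).2; split; first exact: denom_ratioP.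
exact: ratfun_repr.
Qed.

Lemma eulerD i f g : euler i (f + g) = euler i f + euler i g.
Proof.
have [p [q [q0 ->]]] := ratfunP f; have [p' [q' [q'0 ->]]] := ratfunP g.
have F0 (a : {mpoly F[k]}) : a != 0 -> a%:F != 0 by rewrite tofrac_eq0.
rewrite addf_div ?F0 // -!rmorphM -rmorphD !eulerE ?mulf_neq0 //.
rewrite addf_div ?F0 ?expf_neq0 //; apply/eqP.
rewrite eqr_div ?F0 ?mulf_neq0 ?F0 ?expf_neq0 ?mulf_neq0 //; apply/eqP.
rewrite /ratvar -!(rmorphM, rmorphD); congr _%:F.
rewrite !(mderivD, mderivM) !expr2; ring.
Qed.

Lemma eulerM i f g : euler i (f * g) = euler i f * g + f * euler i g.
Proof.
have [p [q [q0 ->]]] := ratfunP f; have [p' [q' [q'0 ->]]] := ratfunP g.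
have F0 (a : {mpoly F[k]}) : a != 0 -> a%:F != 0 by rewrite tofrac_eq0.
rewrite mulf_div -!rmorphM !eulerE ?mulf_neq0 // !mulf_div.
rewrite addf_div ?F0 ?mulf_neq0 ?F0 ?expf_neq0 //; apply/eqP.
rewrite eqr_div ?F0 ?mulf_neq0 ?F0 ?expf_neq0 ?mulf_neq0 ?F0 ?expf_neq0 //; apply/eqP.
rewrite /ratvar -!(rmorphM, rmorphD); congr _%:F.
rewrite !mderivM !expr2; ring.
Qed.

Lemma euler_ratconst i (c : F) : euler i (ratconst k c) = 0.
Proof.
rewrite /ratconst -[_%:F]divr1 -[1 in LHS](rmorph1 (@FracField.tofrac {mpoly F[k]})).
rewrite eulerE ?oner_neq0 // mderivC -mpolyC1 mderivC mul0r mulr0 subr0.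
by rewrite rmorph0 mulr0 mul0r.
Qed.

Lemma euler_ratvar i j : euler i (ratvar F j) = (i == j)%:R * ratvar F j.
Proof.
rewrite {1}/ratvar -[_%:F]divr1 -[1 in LHS](rmorph1 (@FracField.tofrac {mpoly F[k]})).
rewrite eulerE ?oner_neq0 // -mpolyC1 mderivC mulr0 subr0 mpolyC1 mulr1.
rewrite expr1n rmorph1 divr1 mderivX mnm1E eq_sym.
have [->|_] := eqVneq i j; last by rewrite scale0r rmorph0 mulr0 mul0r.
by rewrite scale1r mul1r -[X in (X - _)%MM]add0m addmK mpolyX0 rmorph1 mulr1.
Qed.

(** Homogeneity of degree [n] in the variable [i]. Degrees add under products, so eigenvalues of
    Laurent monomials follow without computing derivatives. *)
Definition euler_weight i (n : int) f := euler i f = n%:~R * f.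

Lemma euler_weightM i n m f g :
  euler_weight i n f -> euler_weight i m g -> euler_weight i (n + m) (f * g).
Proof. rewrite /euler_weight eulerM => -> ->; rewrite intrD; ring. Qed.

Lemma euler_weight_ratconst i c : euler_weight i 0 (ratconst k c).
Proof. by rewrite /euler_weight euler_ratconst mul0r. Qed.

Lemma euler_weight1 i : euler_weight i 0 1.
Proof.
have -> : 1 = ratconst k (1 : F) by rewrite /ratconst mpolyC1 rmorph1.
exact: euler_weight_ratconst.
Qed.

Lemma euler_weightX i n f m :
  euler_weight i n f -> euler_weight i (n * m%:Z) (f ^+ m).
Proof.
move=> fn; elim: m => [|m IH]; first by rewrite mulr0; apply: euler_weight1.
by rewrite exprS -addn1 PoszD mulrDr mulr1 addrC; apply: euler_weightM.
Qed.

(** Apply the product rule to [f * f^-1 = 1]. *)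
Lemma euler_weightV i n f : f != 0 -> euler_weight i n f -> euler_weight i (- n) f^-1.
Proof.
move=> f0 fn; have := euler_weight1 i.
rewrite /euler_weight mul0r -[X in euler i X](mulfV f0) eulerM fn.
rewrite addrC => /eqP; rewrite addr_eq0 => /eqP E; apply: (mulfI f0).
by rewrite E mulrNz mulNr mulrN mulrCA mulrA.
Qed.

Lemma euler_weight_ratvarXz i j (n : int) :
  euler_weight i ((i == j)%:Z * n) (ratvar F j ^ n).
Proof.
have H m : euler_weight i ((i == j)%:Z * m%:Z) (ratvar F j ^+ m).
  by apply: euler_weightX; rewrite /euler_weight euler_ratvar.
case: n => m //; rewrite NegzE -exprnN mulrN; apply: euler_weightV => //.
by rewrite expf_neq0 // ratvar_neq0.
Qed.

Lemma euler_weight_prod i (J : finType) (n : J -> int) (f : J -> ratfun F k) :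
  (forall j, euler_weight i (n j) (f j)) ->
  euler_weight i (\sum_j n j) (\prod_j f j).
Proof.
move=> H; elim/big_rec2: _ => [|j m g _ IH]; first exact: euler_weight1.
exact: euler_weightM.
Qed.

Lemma euler_comp_sum (J : finType) (m : 'I_k -> nat) (f : J -> ratfun F k) :
  (\big[comp/id]_(i < k) iter (m i) (@euler F k i)) (\sum_j f j) =
  \sum_j (\big[comp/id]_(i < k) iter (m i) (@euler F k i)) (f j).
Proof.
have it i n (h : J -> ratfun F k) :
    iter n (euler i) (\sum_j h j) = \sum_j iter n (euler i) (h j).
  elim: n => //= n ->.
  apply: (big_morph (euler i)); first exact: eulerD.
  by have := euler_ratconst i 0; rewrite /ratconst mpolyC0 rmorph0.
pose P (A : ratfun F k -> ratfun F k) := A (\sum_j f j) = \sum_j A (f j).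
apply: (big_rec P) => // i A _ AE; rewrite /P /= AE; exact: it.
Qed.

(** The scalars produced by each operator have weight 0 in every variable, hence pass through the
    remaining operators; the induction carries this invariant. *)
Lemma euler_comp_weight (m : 'I_k -> nat) (ni : 'I_k -> int) f :
  (forall i, euler_weight i (ni i) f) ->
  (\big[comp/id]_(i < k) iter (m i) (@euler F k i)) f =
  (\prod_(i < k) (ni i)%:~R ^+ m i) * f.
Proof.
move=> fw.
have intw i (z : int) : euler_weight i 0 z%:~R.
  have -> : z%:~R = ratconst k (z%:~R : F) by rewrite /ratconst !rmorph_int.
  exact: euler_weight_ratconst.
have it i n b : (forall j, euler_weight j 0 b) ->
    iter n (euler i) (b * f) = (ni i)%:~R ^+ n * b * f.
  move=> b0; elim: n => [|n IH]; first by rewrite mul1r.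
  have : euler_weight i (0 + ni i) ((ni i)%:~R ^+ n * b * f).
    apply: euler_weightM (fw i); rewrite -[0]addr0; apply: euler_weightM (b0 i).
    by rewrite -(mul0r (n%:Z)); apply: euler_weightX.
  by rewrite iterS IH add0r => ->; rewrite exprS !mulrA.
pose P (A : ratfun F k -> ratfun F k) b :=
  (forall j, euler_weight j 0 b) /\ A f = b * f.
suff [] : P (\big[comp/id]_(i < k) iter (m i) (@euler F k i))
            (\prod_(i < k) (ni i)%:~R ^+ m i) by [].
apply: (big_rec2 P); first by split; [exact: euler_weight1|rewrite mul1r].
move=> i b A _ [b0 Af]; split; last by rewrite /= Af it.
move=> j; rewrite -[0]add0r; apply: euler_weightM (b0 j).
by rewrite -(mul0r ((m i)%:Z)); apply: euler_weightX.
Qed.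

End Euler.

(** For each permutation, expand the product of sums over all choices of one exponent per variable.
    Every term is a joint eigenvector, and its eigenvalue is a product over the variables, so the
    sum factors again into matrix entries. *)
Lemma opdet_euler_powers (F : fieldType) k N (c : 'I_N -> F) (l : 'I_N -> int) :
  opdet (fun i j => iter j (@euler F k i))
    (\prod_(j < k) \sum_(a < N) ratconst k (c a) * ratvar F j ^ l a) =
  \det (\matrix_(i < k, m < k)
    \sum_(a < N) ratconst k (c a) * (l a)%:~R ^+ m * ratvar F i ^ l a).
Proof.
apply: eq_bigr => s _; congr (_ * _).
rewrite bigA_distr_bigA euler_comp_sum.
under [RHS]eq_bigr do rewrite mxE.
rewrite bigA_distr_bigA; apply: eq_bigr => f _.
rewrite (@euler_comp_weight F k _ (fun i => l (f i))) => [|i].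
  by rewrite -big_split; apply: eq_bigr => i _; rewrite /= mulrCA mulrA.
(* Only the factor in the variable [i] itself contributes to the weight in that variable. *)
have -> : l (f i) = \sum_(j < k) (0 + (i == j)%:Z * l (f j)).
  rewrite (bigD1 i) //= eqxx mul1r add0r big1 ?addr0 // => j /negbTE.
  by rewrite eq_sym => ->; rewrite mul0r.
apply: euler_weight_prod => j; apply: euler_weightM.
  exact: euler_weight_ratconst.
exact: euler_weight_ratvarXz.
Qed.

(** * Characteristic zero and distinctness of the exponents *)

Lemma ratfun_natr_eq0 (F : fieldType) k (n : nat) : [pchar F] =i pred0 ->
  (n%:R == 0 :> ratfun F k) = (n == 0%N).
Proof.
move/pcharf0P => F0.
have -> : n%:R = ratconst k (n%:R : F) by rewrite /ratconst !rmorph_nat.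
by rewrite /ratconst tofrac_eq0 mpolyC_eq0 F0.
Qed.

Lemma intr_inj_pchar0 (F : fieldType) : [pchar F] =i pred0 ->
  injective (intr : int -> F).
Proof.
move/pcharf0P => F0 a b /eqP; rewrite -subr_eq0 -intrB => E.
apply/eqP; rewrite -subr_eq0; move: E; case: (a - b) => n.
  by rewrite -pmulrn F0.
by rewrite NegzE mulrNz oppr_eq0 -pmulrn F0.
Qed.

Lemma pchar_ratfun (F : fieldType) k :
  [pchar F] =i pred0 -> [pchar ratfun F k] =i pred0.
Proof. by move=> F0; apply/pcharf0P => n; rewrite ratfun_natr_eq0. Qed.

(** A weakly decreasing sequence plus the strictly decreasing N - j is strictly decreasing. *)
Lemma shifted_part_inj N (lam : N.-tuple int) :
  is_signature lam -> injective (shifted_part lam).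
Proof.
move=> sig.
have anti (i j : 'I_N) : (i < j)%N -> tnth lam j <= tnth lam i.
  move=> ij; rewrite !(tnth_nth 0).
  apply: (sorted_ltn_nth _ _ sig) => //; rewrite ?inE ?size_tuple //.
  by move=> y x z /=; lia.
move=> i j; rewrite /shifted_part => E; apply: val_inj.
have := ltn_ord i; have := ltn_ord j.
by case: (ltngtP i j) => // [/[dup]/anti|/[dup]/anti]; lia.
Qed.

(** * The determinant formula for normalized Schur functions and the theorem *)

Lemma ratio_cancel (K : fieldType) (a b v q r t : K) : a != 0 -> q != 0 ->
  b * (v * q) = a * (r * q) * t -> b / a * v = r * t.
Proof.
move=> a0 q0 E; apply: (mulIf q0); apply: (mulfI a0).
transitivity (b * (v * q)); first by field.
by rewrite E; ring.
Qed.

Lemma ratio_solve (K : fieldType) (s v w r t : K) : v != 0 -> w != 0 ->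
  s * (v * w) = r * t -> s = v^-1 * (r / w) * t.
Proof.
move=> v0 w0 E; apply: (mulIf (mulf_neq0 v0 w0)); rewrite E.
by field; rewrite w0.
Qed.

(** Both evaluations in the ratio are multiples of the same determinant of powers of the l_j: the
    denominator by the case r = 0, the numerator by [det_moment_rows]. This form covers one variable
    and [k] variables alike. *)
Lemma normalized_schur_det (F : fieldType) (hF : [pchar F] =i pred0) k N
    (lam : N.-tuple int) (sig : is_signature lam) (c : 'I_N -> F)
    (xs : seq (ratfun F k)) (hr : (size xs <= N)%N) :
  (forall m, (m < N)%N ->
     \sum_j c j * (shifted_part lam j)%:~R ^+ m = (m.+1 == N)%:R) ->
  (forall i, nth 1 xs i != 0) ->
  normalized_schur lam xs *
    ((\prod_(i < size xs) \prod_(j < size xs | (i < j)%N) (nth 1 xs i - nth 1 xs j))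
     * \prod_(i < size xs) (nth 1 xs i - 1) ^+ (N - size xs)) =
  (\prod_(i < size xs) ((N - i.+1)`!)%:R) *
  \det (\matrix_(i < size xs, m < size xs)
    \sum_(a < N) ratconst k (c a) * (shifted_part lam a)%:~R ^+ m
                 * nth 1 xs i ^ shifted_part lam a).
Proof.
move=> cE x0.
have [h hE] := ratconst_is_rmorph F k.
have cE' m : (m < N)%N -> \sum_j ratconst k (c j) * (shifted_part lam j)%:~R ^+ m
    = (m.+1 == N)%:R :> ratfun F k.
  move=> /cE /(congr1 h); rewrite rmorph_sum rmorph_nat => <-.
  by apply: eq_bigr => j _; rewrite rmorphM rmorphXn rmorph_int /= hE.
have fact0 (P : pred 'I_N) :
    \prod_(i < N | P i) ((N - i.+1)`!)%:R != 0 :> ratfun F k.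
  apply/prodf_neq0 => i _; rewrite ratfun_natr_eq0 // -lt0n; exact: fact_gt0.
have X1 (i : 'I_N) : (size xs <= i)%N -> nth 1 xs i = 1 by apply: nth_default.
have := laurent_eval_schur lam hr (fun i : 'I_N => x0 i) X1.
rewrite (det_moment_rows hr _ cE').
have := @laurent_eval_schur F N lam k (fun=> 1) 0 (leq0n N)
  (fun=> oner_neq0 _) (fun _ _ => erefl).
rewrite !big_ord0 !mul1r.
set A := \det (\matrix_(i < N, j < N) (_ ^+ (N - i.+1))).
move=> E0E E1E.
(* This is a Vandermonde determinant in the l_j, which stay distinct in characteristic zero. *)
have A0 : A != 0.
  rewrite /A -det_tr [X in \det X](_ : _ = \matrix_(i < N, j < N)
    (shifted_part lam i)%:~R ^+ (N - j.+1)); last by apply/matrixP=> i j; rewrite !mxE.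
  rewrite det_rev_vandermonde; apply/prodf_neq0 => i _; apply/prodf_neq0 => j ij.
  rewrite subr_eq0 (inj_eq (intr_inj_pchar0 (@pchar_ratfun F k hF))).
  by rewrite (inj_eq (shifted_part_inj sig)) neq_ltn ij.
rewrite /normalized_schur; move: E0E E1E.
set E0 := laurent_eval _ (fun=> 1); set E1 := laurent_eval _ _.
set T := \det (\matrix_(i, m) \sum_(a < N) _).
set V := _ * \prod_(i < size xs) (nth 1 xs i - 1) ^+ _.
set Q := \prod_(i < N | (size xs <= i)%N) _.
move=> E0E E1E; have {}E1E : E1 * (V * Q) = A * T := E1E.
have E00 : E0 != 0 by apply: contraNneq A0 => E00; rewrite -E0E E00 mul0r.
(* The factorials from index [size xs] on occur in both evaluations and cancel; the others survive
   as the prefactor. *)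
have E0E' : E0 * ((\prod_(i < size xs) ((N - i.+1)`!)%:R) * Q) = A.
  rewrite -E0E [in RHS](bigID (fun i : 'I_N => (i < size xs)%N)) /=.
  rewrite (big_ord_narrow hr) /=; congr (_ * (_ * _)).
  by apply: eq_bigl => i; rewrite -leqNgt.
have Q0 : Q != 0 := fact0 _.
move: (\prod_(i < size xs) _) E0E' E1E E00 Q0 => Fr.
move: E0 E1 V Q T A {A0 E0E} => E0 E1 V Q T A <- E1E E00 Q0.
exact: ratio_cancel E00 Q0 E1E.
Qed.

Theorem theorem1p2 (F : fieldType) (hF : [pchar F] =i pred0) (k N : nat)
    (hk : (1 <= k)%N) (hkN : (k <= N)%N)
    (lam : N.-tuple int) (hlam : is_signature lam) :
  let x (i : 'I_k) : ratfun F k := ratvar F i in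
  normalized_schur lam [seq x i | i <- enum 'I_k] =
    (\prod_(i < k) \prod_(j < k | (i < j)%N) (x i - x j))^-1
    * (\prod_(i < k) (((N - i.+1)`!)%:R / (x i - 1) ^+ (N - k)))
    * opdet (fun i j => iter j (@euler F k i))
        (\prod_(j < k) (normalized_schur lam [:: x j]
                        * ((x j - 1) ^+ (N - 1) / ((N - 1)`!)%:R))).
Proof.
move=> x.
have y_inj : injective (fun a => (shifted_part lam a)%:~R : F).
  by move=> a b /(intr_inj_pchar0 hF)/(shifted_part_inj hlam).
have [c cE] := moment_weights y_inj.
have x1 i : x i - 1 != 0.
  rewrite subr_eq0 /x /ratvar -(rmorph1 (@FracField.tofrac {mpoly F[k]})) tofrac_eq.
  apply/eqP => /mpolyP/(_ U_(i)%MM)/eqP.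
  by rewrite mcoeffX mcoeff1 eqxx mnm1_eq0 oner_eq0.
(* The one-variable case identifies each factor under the operator as the weighted sum of powers
   x^{l_a}. *)
have single j : normalized_schur lam [:: x j] * ((x j - 1) ^+ (N - 1) / ((N - 1)`!)%:R)
    = \sum_(a < N) ratconst k (c a) * x j ^ shifted_part lam a.
  have hN : (size [:: x j] <= N)%N := leq_trans hk hkN.
  have xj0 i : nth 1 [:: x j] i != 0.
    by case: i => [|i]; rewrite /= ?nth_nil ?oner_neq0 ?ratvar_neq0.
  have := normalized_schur_det hF hlam hN cE xj0.
  rewrite /= !big_ord1 big_pred0; last by case=> [[]].
  rewrite mul1r det_mx11 mxE => E.
  rewrite mulrA E mulrAC mulfV ?mul1r; last first.
    by rewrite ratfun_natr_eq0 // -lt0n fact_gt0.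
  by apply: eq_bigr => a _; rewrite mulr1.
under [X in opdet _ X]eq_bigr do rewrite single.
rewrite opdet_euler_powers.
set xs := [seq x i | i <- enum 'I_k].
have sz : size xs = k by rewrite size_map size_enum_ord.
have xsE (i : 'I_k) : nth 1 xs i = x i.
  by rewrite (nth_map i) ?size_enum_ord // nth_ord_enum.
have hr : (size xs <= N)%N by rewrite sz.
have xs0 i : nth 1 xs i != 0.
  have [ik|ik] := ltnP i k; first by rewrite (xsE (Ordinal ik)) ratvar_neq0.
  by rewrite nth_default ?sz // oner_neq0.
(* The case of all [k] variables yields the same determinant that the operator produced. *)
have := normalized_schur_det hF hlam hr cE xs0.
move: (normalized_schur lam xs) => S; rewrite sz.
rewrite (eq_bigr (fun i : 'I_k => \prod_(j < k | (i < j)%N) (x i - x j)));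
  last by move=> i _; apply: eq_bigr => j _; rewrite !xsE.
rewrite [X in _ * (_ * X) = _](eq_bigr (fun i : 'I_k => (x i - 1) ^+ (N - k)));
  last by move=> i _; rewrite xsE.
rewrite [X in \det X](_ : _ = \matrix_(i < k, m < k)
    \sum_(a < N) ratconst k (c a) * (shifted_part lam a)%:~R ^+ m
                  * ratvar F i ^ shifted_part lam a); last first.
  by apply/matrixP => i m; rewrite !mxE; apply: eq_bigr => a _; rewrite xsE.
set V := \prod_(i < k) \prod_(j < k | _) _; set W := \prod_(i < k) _ ^+ _ => E.
have V0 : V != 0.
  apply/prodf_neq0 => i _; apply/prodf_neq0 => j ij; rewrite subr_eq0.
  by apply: contraTneq ij => /ratvar_inj ->; rewrite ltnn.
have W0 : W != 0 by apply/prodf_neq0 => i _; rewrite expf_neq0.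
rewrite big_split /= prodfV -/W; exact: ratio_solve V0 W0 E.
Qed.
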